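(* Let $d\ge 1$. There exists a constant $c_d>0$ depending only on $d$ such that for every finite (possibly signed) Borel measure $\mu$ on $\mathbb{R}^d$ $$\liminf_{\lambda\to+\infty}\lambda\,\mathscr{L}^d\big(\{x\in\mathbb{R}^d : \overline{\mathsf{M}}\mu(x)>\lambda\}\big)\ \ge\ c_d\,|\mu^s|(\mathbb{R}^d).$$
   Context: $\mathscr{L}^d$ is the Lebesgue measure on $\mathbb{R}^d$ and $B(x,r)$ is the ball of center $x$ and radius $r$. For a finite (possibly signed) Borel measure $\mu$ on $\mathbb{R}^d$ and $x\in\mathbb{R}^d$, define $$\overline{\mathsf{M}}\mu(x):=\sup_{r>0}\frac{|\mu(B(x,r))|}{\mathscr{L}^d(B(x,r))}\in[0,+\infty],$$ where $|\mu(B(x,r))|$ is the absolute value of the number $\mu(B(x,r))$. $\mu^s$ denotes the singular part of $\mu$ with respect to $\mathscr{L}^d$, and $|\mu^s|$ its total variation measure. *)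

(* Defs.v *)
From HB Require Import structures.
From mathcomp Require Import all_boot all_order all_algebra.
From mathcomp Require Import all_classical all_reals all_analysis.
From mathcomp Require Import measurable_realfun lra.
Set Implicit Arguments.
Unset Strict Implicit.
Unset Printing Implicit Defensive.
Import Order.TTheory GRing.Theory Num.Theory.
Import numFieldNormedType.Exports.
Local Open Scope classical_set_scope.
Local Open Scope ring_scope.
Local Open Scope ereal_scope.

(* The topology of 'rV[R]_d in the library is the usual one of R^d, so this
   is the Borel sigma-algebra. *)
HB.instance Definition _ (R : realType) (d : nat) :=
  @isMeasurable.Build (sigma_display (@open 'rV[R]_d)) 'rV[R]_d
    <<s @open 'rV[R]_d >>
    (@sigma_algebra0 _ setT open) (@sigma_algebraC _ open)
    (@sigma_algebra_bigcup _ setT open).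

Section lebesgue_tuple.
Context {R : realType}.
Local Notation mR := (measurableTypeR R).

Definition tcons n (p : mR * n.-tuple mR) : n.+1.-tuple mR :=
  [tuple of p.1 :: p.2].

Lemma measurable_tcons n : measurable_fun [set: _] (@tcons n).
Proof. by apply: measurable_cons. Qed.

Lemma measurable_tbox n (A : 'I_n -> set mR) :
  (forall i, measurable (A i)) ->
  measurable [set t : n.-tuple mR | forall i, A i (tnth t i)].
Proof.
move=> mA.
rewrite (_ : mkset _ =
    \bigcap_(i in [set: 'I_n]) ((@tnth _ mR ^~ i) @^-1` A i)); last first.
  by apply/seteqP; split => [t tA i _|t tA i]; exact: tA.
apply: fin_bigcap_measurable; first exact: finite_finset.
by move=> i _; rewrite -[X in measurable X]setTI; exact: measurable_tnth.
Qed.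

Lemma centered_cover n (u : 'I_n -> R) :
  exists k, forall i, [set` `[- k%:R, k%:R]%R] (u i).
Proof.
exists (\max_(i < n) (Num.truncn `|u i|).+1)%N => i.
rewrite /= in_itv/= -ler_norml.
apply/ltW/(lt_le_trans (truncnS_gt _)).
by rewrite ler_nat; exact: (leq_bigmax i).
Qed.

Lemma lebesgue_measure_centered k :
  lebesgue_measure [set` `[- k%:R : R, k%:R]%R] < +oo.
Proof. by rewrite lebesgue_measure_itv/=; case: ifP => // _; rewrite ltry. Qed.

Section step.
Variables (n : nat) (m : {sigma_finite_measure set (n.-tuple mR) -> \bar R}).

Definition lebesgue_tupleS : set (n.+1.-tuple mR) -> \bar R :=
  pushforward (@lebesgue_measure R \x m) (@tcons n).

Let lebesgue_tupleS0 : lebesgue_tupleS set0 = 0.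
Proof. by rewrite /lebesgue_tupleS /pushforward preimage_set0 measure0. Qed.

Let lebesgue_tupleS_ge0 A : 0 <= lebesgue_tupleS A.
Proof. by rewrite /lebesgue_tupleS /pushforward; apply: measure_ge0. Qed.

Let lebesgue_tupleS_sigma_additive : semi_sigma_additive lebesgue_tupleS.
Proof.
move=> F mF tF mUF.
rewrite /lebesgue_tupleS /pushforward preimage_bigcup.
apply: measure_semi_sigma_additive.
- by move=> k; rewrite -[X in measurable X]setTI; exact: measurable_tcons.
- apply/trivIsetP => i j _ _ ij; rewrite -preimage_setI.
  by move/trivIsetP : tF => /(_ _ _ _ _ ij) ->//; rewrite preimage_set0.
- by rewrite -preimage_bigcup -[X in measurable X]setTI; exact: measurable_tcons.
Qed.

HB.instance Definition _ := isMeasure.Build _ _ _ lebesgue_tupleS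
  lebesgue_tupleS0 lebesgue_tupleS_ge0 lebesgue_tupleS_sigma_additive.

Lemma measurable_tbehead (G : set (n.-tuple mR)) : measurable G ->
  measurable [set t : n.+1.-tuple mR | G [tuple of behead t]].
Proof.
move=> mG; rewrite -[X in measurable X]setTI.
exact: (@measurable_behead _ mR n).
Qed.

Let lebesgue_tupleS_sigma_finite : sigma_finite setT lebesgue_tupleS.
Proof.
have /sigma_finiteP[G [TG ndG Goo]] := sigma_finiteT m.
pose I k := [set` `[- k%:R : R, k%:R]%R].
exists (fun k => [set t : n.+1.-tuple mR | I k (thead t)] `&`
  [set t : n.+1.-tuple mR | G k [tuple of behead t]]).
  apply/esym/seteqP; split => // t _.
  have [k Ik] := centered_cover (fun _ : 'I_1 => thead t).
  have [l _ Gl] : (\bigcup_i G i) [tuple of behead t] by rewrite -TG.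
  exists (maxn k l) => //; split => /=.
    have := Ik ord0; rewrite /I/= !in_itv/= -!ler_norml => /le_trans; apply.
    by rewrite ler_nat leq_maxl.
  by move: Gl; apply/subsetPset/ndG/leq_maxr.
move=> k; have [mG Gk] := Goo k; split.
  apply: measurableI; last exact: measurable_tbehead.
  rewrite -[X in measurable X]setTI.
  by apply: (@measurable_tnth _ mR n.+1 ord0) => //; exact: measurable_itv.
rewrite /lebesgue_tupleS /pushforward.
rewrite (_ : _ @^-1` _ = I k `*` G k); last first.
  apply/seteqP; split => -[x t] /=; rewrite theadE => -[Ix Gt]; split => //.
    by move: Gt; rewrite (_ : [tuple of _] = t)//; exact/val_inj.
  by rewrite (_ : [tuple of _] = t)//; exact/val_inj.
rewrite product_measure1E//; last exact: measurable_itv.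
apply: lte_mul_pinfty => //.
by rewrite ge0_fin_numE//; exact: lebesgue_measure_centered.
Qed.

HB.instance Definition _ := Measure_isSigmaFinite.Build _ _ _ lebesgue_tupleS
  lebesgue_tupleS_sigma_finite.

Lemma lebesgue_tupleS_box (A : 'I_n.+1 -> set mR) :
  (forall i, measurable (A i)) ->
  lebesgue_tupleS [set t | forall i, A i (tnth t i)] =
  lebesgue_measure (A ord0) *
  m [set t | forall i, A (lift ord0 i) (tnth t i)].
Proof.
move=> mA; rewrite /lebesgue_tupleS /pushforward.
rewrite (_ : _ @^-1` _ =
    A ord0 `*` [set t | forall i, A (lift ord0 i) (tnth t i)]); last first.
  apply/seteqP; split => -[x t] /=.
    move=> At; split; first exact: (At ord0).
    by move=> i; have := At (lift ord0 i); rewrite tnthS.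
  move=> [Ax At] i; case: (unliftP ord0 i) => [j ->|->//].
  by rewrite tnthS.
rewrite product_measure1E//.
exact: (@measurable_tbox n (fun i => A (lift ord0 i))).
Qed.

End step.

Fixpoint lebesgue_tuple n : {sigma_finite_measure set (n.-tuple mR) -> \bar R} :=
  if n is n'.+1 then lebesgue_tupleS (lebesgue_tuple n') else \d_([tuple]).

Lemma lebesgue_tuple_box n (A : 'I_n -> set mR) :
  (forall i, measurable (A i)) ->
  lebesgue_tuple n [set t | forall i, A i (tnth t i)] =
  \prod_(i < n) lebesgue_measure (A i).
Proof.
elim: n A => [|n IH] A mA.
  by rewrite big_ord0 /= diracE mem_set// => -[].
by rewrite big_ord_recl -IH//=; exact: lebesgue_tupleS_box.
Qed.

End lebesgue_tuple.

Section lebesgue_rV.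
Context {R : realType}.
Local Notation mR := (measurableTypeR R).

Definition tuple_rV d (t : d.-tuple mR) : 'rV[R]_d := \row_i tnth t i.

Lemma measurable_tuple_rV d : measurable_fun [set: d.-tuple mR] (@tuple_rV d).
Proof.
apply: (@measurability _ _ _ _ _ _ (@open 'rV[R]_d)) => // _ [U oU <-].
rewrite setTI.
pose B (p : 'rV[rat]_d * nat) : set 'rV[R]_d :=
  ball (map_mx ratr p.1 : 'rV[R]_d) p.2.+1%:R^-1%R.
have mB p : measurable (@tuple_rV d @^-1` B p).
  rewrite (_ : _ @^-1` _ = [set t | forall i,
      ball (ratr (p.1 ord0 i) : R) p.2.+1%:R^-1%R (tnth t i)]).
    apply: (@measurable_tbox _ _ (fun i =>
      ball (ratr (p.1 ord0 i) : R) p.2.+1%:R^-1%R)) => i.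
    by apply: (@open_measurable R); exact: ball_open.
  apply/seteqP; split => t /=.
    by move=> [_ Bt] i; have := Bt ord0 i; rewrite !mxE.
  by move=> Bt; split => // i j; rewrite ord1 !mxE; exact: Bt.
rewrite (_ : _ @^-1` U =
    \bigcup_(p in [set p | B p `<=` U]) (@tuple_rV d @^-1` B p)); last first.
  apply/seteqP; split => [t Ut|t [p pU]]; last exact: pU.
  have /nbhs_ballP[e /= e0 eU] := open_nbhs_nbhs (conj oU Ut).
  have [k ke] : exists k, (k.+1%:R^-1 < e / 2)%R.
    exists (Num.truncn (e / 2)^-1).
    by rewrite invf_plt ?posrE ?divr_gt0// truncnS_gt.
  have k0 : (0 < k.+1%:R^-1 :> R)%R by [].
  have qP i : exists q : rat,
      ball (ratr q : R) k.+1%:R^-1%R (tnth t i : R).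
    have /rat_in_itvoo[q] : (tnth t i < (tnth t i : R) + k.+1%:R^-1)%R.
      by rewrite ltrDl.
    rewrite in_itv/= => /andP[tq qt]; exists q.
    rewrite /ball/= ltr_norml; move: k0 tq qt.
    by move: (k.+1%:R^-1 : R)%R => r *; apply/andP; split; lra.
  have [q {}qP] := choice qP.
  have Bq : B (\row_i q i, k) (tuple_rV t).
    by split => // i j; rewrite ord1 !mxE; exact: qP.
  exists (\row_i q i, k) => //= y By; apply: eU.
  rewrite (splitr e).
  apply: (@ball_triangle R 'rV[R]_d (map_mx ratr (\row_i q i))).
    by apply: (le_ball (ltW ke)); exact: ball_sym.
  exact: (le_ball (ltW ke)).
rewrite bigcup_mkcond; apply: countable_bigcupT_measurable.
  exact: countableP.
by move=> p; case: ifP => // _; exact: measurable0.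
Qed.

Variable d : nat.

(* The product is built on tuples, which carry a product sigma-algebra in the
   library, and then transported to row vectors with their Borel sigma-algebra. *)
Definition lebesgue_rV : set 'rV[R]_d -> \bar R :=
  pushforward (@lebesgue_tuple R d) (@tuple_rV d).

Let lebesgue_rV0 : lebesgue_rV set0 = 0.
Proof. by rewrite /lebesgue_rV /pushforward preimage_set0 measure0. Qed.

Let lebesgue_rV_ge0 A : 0 <= lebesgue_rV A.
Proof. by rewrite /lebesgue_rV /pushforward; apply: measure_ge0. Qed.

Let lebesgue_rV_sigma_additive : semi_sigma_additive lebesgue_rV.
Proof.
move=> F mF tF mUF.
rewrite /lebesgue_rV /pushforward preimage_bigcup.
apply: measure_semi_sigma_additive.
- by move=> k; rewrite -[X in measurable X]setTI; exact: measurable_tuple_rV.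
- apply/trivIsetP => i j _ _ ij; rewrite -preimage_setI.
  by move/trivIsetP : tF => /(_ _ _ _ _ ij) ->//; rewrite preimage_set0.
- by rewrite -preimage_bigcup -[X in measurable X]setTI; exact: measurable_tuple_rV.
Qed.

HB.instance Definition _ := isMeasure.Build _ _ _ lebesgue_rV
  lebesgue_rV0 lebesgue_rV_ge0 lebesgue_rV_sigma_additive.

Lemma lebesgue_rV_box (A : 'I_d -> set mR) :
  (forall i, measurable (A i)) ->
  lebesgue_rV [set x : 'rV[R]_d | forall i, A i (x ord0 i)] =
  \prod_(i < d) lebesgue_measure (A i).
Proof.
move=> mA; rewrite -lebesgue_tuple_box// /lebesgue_rV /pushforward.
congr (lebesgue_tuple _ _); apply/seteqP.
by split => t /= At i; have := At i; rewrite mxE.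
Qed.

Lemma measurable_coord (i : 'I_d) :
  measurable_fun [set: 'rV[R]_d] (fun x : 'rV[R]_d => x ord0 i : mR).
Proof.
apply: (measurability _ (RGenOpens.measurableE R)) => _ [_ [a [b ->] <-]].
rewrite setTI; apply: sub_sigma_algebra.
apply: open_comp; last exact: interval_open.
by move=> x _; exact: coord_continuous.
Qed.

Let lebesgue_rV_sigma_finite : sigma_finite setT lebesgue_rV.
Proof.
pose I k := [set` `[- k%:R : R, k%:R]%R].
exists (fun k => [set x : 'rV[R]_d | forall i, I k (x ord0 i)]).
  apply/esym/seteqP; split => // x _.
  by have [k Ik] := centered_cover (x ord0); exists k.
move=> k; split; last first.
  rewrite (@lebesgue_rV_box (fun=> I k)).
    rewrite ltey_eq prode_fin_num// => i _.
    by rewrite ge0_fin_numE//; exact: lebesgue_measure_centered.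
  by move=> i; exact: measurable_itv.
rewrite (_ : mkset _ = \bigcap_(i in [set: 'I_d])
    ((fun x : 'rV[R]_d => x ord0 i : mR) @^-1` I k)); last first.
  by apply/seteqP; split => [x Ix i _|x Ix i]; exact: Ix.
apply: fin_bigcap_measurable; first exact: finite_finset.
move=> i _; rewrite -[X in measurable X]setTI; apply: measurable_coord => //.
exact: measurable_itv.
Qed.

HB.instance Definition _ := Measure_isSigmaFinite.Build _ _ _ lebesgue_rV
  lebesgue_rV_sigma_finite.

End lebesgue_rV.
Arguments lebesgue_rV R d : clear implicits.

Section lebesgue_decomposition.
Context d (T : measurableType d) (R : realType).
Implicit Types nu : {charge set T -> \bar R}.

Definition charge_total_variation nu : set T -> \bar R :=
  charge_variation
    (projT2 (cid (projT2 (cid (Hahn_decomposition nu))))).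

Definition mutually_singular nu (mu : set T -> \bar R) :=
  exists N, [/\ measurable N, mu N = 0 & nu.-null_set (~` N)].

Definition is_lebesgue_decomposition (mu : set T -> \bar R) nu
    (nua nus : {charge set T -> \bar R}) :=
  [/\ nua `<< mu, mutually_singular nus mu &
      forall A, measurable A -> nu A = nua A + nus A].

Lemma lebesgue_decomposition (mu : {measure set T -> \bar R}) nu :
  exists nus nua : {charge set T -> \bar R},
    is_lebesgue_decomposition mu nu nua nus.
Proof.
have [P [Q nuPQ]] := Hahn_decomposition nu.
pose V : {measure set T -> \bar R} := charge_variation nuPQ.
pose S := [set V N | N in [set N | measurable N /\ mu N = 0]].
have Vfin A : measurable A -> V A \is a fin_num.
  by move=> mA; exact: (fin_num_measure (charge_variation nuPQ)).
have Sle x : S x -> x <= V setT.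
  by move=> [N [mN _] <-]; apply: le_measure => //; rewrite inE.
have Ssup0 : 0 <= ereal_sup S.
  by apply: ereal_sup_ubound; exists set0; rewrite ?measure0.
have Sfin : ereal_sup S \is a fin_num.
  rewrite ge0_fin_numE//; apply: (@le_lt_trans _ _ (V setT)).
    exact: ub_ereal_sup.
  by rewrite ltey_eq Vfin.
have FP n : exists N, [/\ measurable N, mu N = 0 &
    ereal_sup S - n.+1%:R^-1%:E < V N].
  have /(ub_ereal_sup_adherent)/(_ Sfin)[_ [N [mN N0] <-]] :
    (0 < n.+1%:R^-1 :> R)%R by [].
  by exists N.
have [F {}FP] := choice FP.
pose N := \bigcup_n F n.
have mN : measurable N by apply: bigcup_measurable => n _; have [] := FP n.
have muN : mu N = 0.
  apply/negligibleP => //; apply: negligible_bigcup => n.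
  by have [mF F0 _] := FP n; apply/negligibleP.
have VN : V N = ereal_sup S.
  apply/eqP; rewrite eq_le; apply/andP; split.
    by apply: ereal_sup_ubound; exists N.
  apply/lee_addgt0Pr => e e0.
  have [n ne] : exists n, (n.+1%:R^-1 < e)%R.
    exists (Num.truncn e^-1).
    by rewrite invf_plt ?posrE// truncnS_gt.
  have [mF _] := FP n; rewrite lteBlDr// => /ltW/le_trans; apply.
  apply: leeD; last by rewrite lee_fin ltW.
  by apply: le_measure; rewrite ?inE//; exact: bigcup_sup.
exists (crestr0 nu mN), (crestr0 nu (measurableC mN)); split => /=.
- apply/null_content_dominatesP => A mA muA.
  rewrite /crestr0 mem_set// /crestr.
  have mAN : measurable (A `&` ~` N) by apply: measurableI => //; exact: measurableC.
  apply/eqP; rewrite -abse_eq0 eq_le abse_ge0 andbT.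
  apply: (le_trans (abse_charge_variation nuPQ mAN)).
  have : V (N `|` (A `&` ~` N)) <= V N.
    rewrite VN; apply: ereal_sup_ubound; exists (N `|` (A `&` ~` N)) => //; split.
      exact: measurableU.
    apply/negligibleP; first exact: measurableU.
    apply: negligibleU; apply/negligibleP => //.
    apply/eqP; rewrite eq_le measure_ge0 andbT -muA.
    by apply: le_measure; rewrite ?inE.
  rewrite measureU//; last by rewrite setICA setICr setI0.
  by rewrite -leeBrDl ?Vfin// subee// Vfin.
- exists N; split => // A mA AN; rewrite /= /crestr0 mem_set// /crestr.
  by rewrite (_ : A `&` N = set0) ?charge0//; exact/disjoints_subset.
- move=> A mA; rewrite /= /crestr0 mem_set// /crestr.
  by rewrite (chargeDI nu mA mN) setDE.
Qed.

Definition singular_part (mu : {measure set T -> \bar R}) nu :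
    {charge set T -> \bar R} :=
  projT1 (cid (lebesgue_decomposition mu nu)).

Lemma singular_partP (mu : {measure set T -> \bar R}) nu :
  exists nua : {charge set T -> \bar R},
    is_lebesgue_decomposition mu nu nua (singular_part mu nu).
Proof. by rewrite /singular_part; case: cid. Qed.

Lemma lebesgue_decomposition_uniq (mu : {measure set T -> \bar R}) nu
    (nua nus nua' nus' : {charge set T -> \bar R}) :
  is_lebesgue_decomposition mu nu nua nus ->
  is_lebesgue_decomposition mu nu nua' nus' ->
  forall A, measurable A -> nus A = nus' A.
Proof.
move=> [/null_content_dominatesP amu [N [mN muN sN]] E].
move=> [/null_content_dominatesP amu' [N' [mN' muN' sN']] E'] A mA.
have mNN : measurable (N `|` N') by exact: measurableU.
have muNN : mu (N `|` N') = 0.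
  by apply/negligibleP => //; apply: negligibleU; apply/negligibleP.
have mI : measurable (A `&` (N `|` N')) by exact: measurableI.
have mD : measurable (A `\` (N `|` N')) by exact: measurableD.
have muI : mu (A `&` (N `|` N')) = 0.
  apply/eqP; rewrite eq_le measure_ge0 andbT -muNN.
  by apply: le_measure; rewrite ?inE.
rewrite (chargeDI nus mA mNN) (chargeDI nus' mA mNN).
have DN : A `\` (N `|` N') `<=` ~` N by move=> x [_ nx] Nx; apply: nx; left.
have DN' : A `\` (N `|` N') `<=` ~` N' by move=> x [_ nx] Nx; apply: nx; right.
rewrite sN// sN'// !add0e.
by have := E _ mI; rewrite E'// amu// amu'// !add0e => ->.
Qed.

End lebesgue_decomposition.

(* Library norm and balls on 'rV[R]_d are those of the sup norm, whence the
   explicit definition of the Euclidean ball. *)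
Section maximal_function.
Context {R : realType} {d : nat}.

Definition euclidean_ball (x : 'rV[R]_d) (r : R) : set 'rV[R]_d :=
  [set y | (Num.sqrt (\sum_(i < d) (y ord0 i - x ord0 i) ^+ 2) < r)%R].

Definition maximal_function (mu : {charge set 'rV[R]_d -> \bar R})
    (x : 'rV[R]_d) : \bar R :=
  ereal_sup [set `|mu (euclidean_ball x r)|
                 / lebesgue_rV R d (euclidean_ball x r) | r in [set r | 0 < r]%R].

End maximal_function.

(* Main.v *)
(* Write mu = a - b with a, b the Jordan parts, and let A be an L-null set on which
   b vanishes; it suffices to bound a(A) (and, exchanging a and b, its analogue) by
   a constant times lambda L({M mu > lambda}) for large lambda. By regularity A may
   be replaced by a compact K. Let Q(x,r) be the cube (sup-norm ball) of center x and
   radius r, and v(r) its volume. For x in K choose an almost maximal radius r with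
   a(Q(x,r)) >= 2 L' v(r), L' being lambda up to a dimensional constant; then
   a(Q(x,t)) < 2 L' v(t) for t >= 2r, and r is small, uniformly in x, when lambda is
   large.
   - If b(Q(x,Cr)) < L' v(r), no cancellation is possible in balls comparable to
     Q(x,r), and all of Q(x,r) lies in {M mu > lambda}.
   - If b(Q(x,Cr)) >= L' v(r), then b controls a on Q(x,Cr), which lies in a small
     neighbourhood of K, where b is small.
   - If no r exists, L controls a on all cubes centered at x, and neighbourhoods of
     K have small L-measure.
   A finite subcover of K and Vitali's selection in each of the three families bound
   the a-mass of the last two by a(K)/2, and that of the first by L({M mu > lambda}).
   This replaces the differentiation of mu along its variation (Besicovitch). *)
Require Import Defs.
From mathcomp Require Import all_boot all_order all_algebra.
From mathcomp Require Import all_classical all_reals all_analysis.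
From mathcomp Require Import measurable_realfun ring lra.
Set Implicit Arguments.
Unset Strict Implicit.
Unset Printing Implicit Defensive.
Import Order.TTheory GRing.Theory Num.Theory.
Import numFieldNormedType.Exports.
Local Open Scope classical_set_scope.
Local Open Scope ring_scope.

(** * Vitali selection for finite families of cubes *)

Lemma open_measurable_rV (R : realType) (d : nat) (U : set 'rV[R]_d) :
  open U -> measurable U.
Proof. by move=> oU; exact: sub_sigma_algebra. Qed.

Lemma closed_measurable_rV (R : realType) (d : nat) (F : set 'rV[R]_d) :
  closed F -> measurable F.
Proof.
move=> cF; rewrite -(setCK F); apply: measurableC.
by apply: open_measurable_rV; exact: closed_openC.
Qed.

Definition ball_union {R : realType} {d : nat} (s : seq ('rV[R]_d * R)) :=
  \bigcup_(p in [set` s]) ball p.1 p.2.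

Lemma open_ball_union (R : realType) (d : nat) (s : seq ('rV[R]_d * R)) :
  open (ball_union s).
Proof. by apply: bigcup_open => p _; exact: ball_open. Qed.

Lemma seq_has_max (R : realType) (T : eqType) (f : T -> R) (s : seq T) :
  s != [::] -> exists2 p, p \in s & {in s, forall q, f q <= f p}.
Proof.
elim: s => // x [_ _|y s /(_ isT)[p ps pmax] _].
  by exists x; rewrite ?mem_head// => q; rewrite inE => /eqP ->.
have [xp|px] := leP (f x) (f p).
  exists p; first by rewrite inE ps orbT.
  by move=> q; rewrite inE => /predU1P[->//|/pmax].
exists x; first exact: mem_head.
move=> q; rewrite inE => /predU1P[->//|/pmax qp].
exact: le_trans qp (ltW px).
Qed.

(* Vitali's greedy selection: the ball of largest radius swallows, once tripled,
   all the balls that it meets. *)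
Lemma vitali_measure_le (R : realType) (d : nat)
    (a m : {measure set 'rV[R]_d -> \bar R}) (C : R) (s : seq ('rV[R]_d * R)) :
  (forall p, p \in s -> 0 < p.2 /\
    (a (ball p.1 (3 * p.2)) <= C%:E * m (ball p.1 p.2))%E) -> 0 <= C ->
  (a (ball_union s) <= C%:E * m (ball_union s))%E.
Proof.
move=> + C0.
have mball x r : measurable (ball x r : set 'rV[R]_d).
  by apply: open_measurable_rV; exact: ball_open.
have mbu t : measurable (@ball_union R d t).
  by apply: open_measurable_rV; exact: open_ball_union.
have [n] := ubnP (size s).
elim: n s => // n IH s sn sP.
have [->|s0] := eqVneq s [::].
  by rewrite /ball_union set_nil bigcup_set0 !measure0 mule0.
have [p ps pmax] := seq_has_max (snd : 'rV[R]_d * R -> R) s0.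
pose t := [seq q <- s | `[< ball q.1 q.2 `&` ball p.1 p.2 = set0 >]].
have ts q : q \in t -> q \in s by rewrite mem_filter => /andP[].
have [p0 ap] := sP p ps.
(* The selected ball meets itself, its radius being positive, so it drops out of [t] and the
   induction on the size applies. *)
have pt : (size t < n)%N.
  rewrite -ltnS; apply: leq_trans sn; rewrite ltnS /t size_filter.
  rewrite ltn_neqAle count_size andbT -all_count; apply/negP => /allP/(_ p ps).
  move/asboolP; rewrite setIid => /seteqP[+ _] => /(_ p.1); apply.
  exact: ballxx.
have {}IH := IH t pt (fun q qt => sP q (ts q qt)).
apply: (@le_trans _ _ (a (ball p.1 (3 * p.2) `|` ball_union t))).
  apply: le_measure; rewrite ?inE//; first exact: measurableU.
  move=> x [q /= qs qx].
  have [q0|/eqP/set0P[y [qy py]]] := pselect (ball q.1 q.2 `&` ball p.1 p.2 = set0).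
    right; exists q => //=; rewrite mem_filter qs andbT.
    exact/asboolP.
  left; rewrite (_ : 3 * p.2 = p.2 + p.2 + p.2); last by ring.
  apply: (@le_ball _ _ _ (p.2 + q.2 + q.2)).
    by rewrite !lerD// pmax.
  apply: ball_triangle qx; apply: ball_triangle py _.
  exact: ball_sym.
apply: (le_trans (measureU2 _ _ _)) => //.
apply: (le_trans (leeD ap IH)).
(* The balls kept in [t] avoid the selected one, so the two [m]-masses add up inside the union over
   [s]. *)
rewrite -muleDr//; last by rewrite ge0_adde_def// inE measure_ge0.
apply: lee_wpmul2l; rewrite ?lee_fin// -measureU//.
  apply: le_measure; rewrite ?inE//; first exact: measurableU.
  move=> x [px|[q qt qx]]; first by exists p.
  by exists q => //=; exact: ts.
apply/seteqP; split => // x [px [q /= +]].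
rewrite mem_filter => /andP[/asboolP + _] qx => /seteqP[+ _] => /(_ x).
exact.
Qed.

(** * Continuity from above and thickenings of closed sets *)

Lemma measure_bigcap_small (R : realType) (dsp : measure_display)
    (T : measurableType dsp) (m : {measure set T -> \bar R})
    (D : (set T)^nat) (e : R) :
  (m (D 0%N) < +oo)%E -> (forall n, measurable (D n)) ->
  (forall n p, (n <= p)%N -> D p `<=` D n) -> m (\bigcap_n D n) = 0%E ->
  0 < e -> exists n, (m (D n) <= e%:E)%E.
Proof.
move=> D0 mD dD mD0 e0.
have ndD : {homo D : n p / (n <= p)%N >-> (p <= n)%O}.
  by move=> n p np; apply/subsetPset; exact: dD.
have := nonincreasing_cvg_mu D0 mD (bigcap_measurableType (fun n _ => mD n)) ndD.
have me : (m (\bigcap_n D n) < e%:E)%E by rewrite mD0 lte_fin.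
move/(_ _ (open_ereal_lt' me)) => [n _ nP].
by exists n; apply: ltW; apply: nP => /=.
Qed.

Definition thickening {R : realType} {d : nat} (K : set 'rV[R]_d) (e : R) :=
  \bigcup_(x in K) ball x e.

Lemma open_thickening (R : realType) (d : nat) (K : set 'rV[R]_d) e :
  open (thickening K e).
Proof. by apply: bigcup_open => x _; exact: ball_open. Qed.

Lemma sub_thickening (R : realType) (d : nat) (K : set 'rV[R]_d) e f :
  e <= f -> thickening K e `<=` thickening K f.
Proof. by move=> ef x [y Ky yx]; exists y => //; exact: le_ball yx. Qed.

Lemma bigcap_thickening (R : realType) (d : nat) (K : set 'rV[R]_d) :
  closed K -> \bigcap_n thickening K n.+1%:R^-1 = K.
Proof.
move=> cK; apply/seteqP; split => [x Kx|x Kx n _]; last first.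
  by exists x => //; exact: ballxx.
apply: cK => B /nbhs_ballP[e /= e0 eB].
have [n ne] : exists n, n.+1%:R^-1 < e.
  exists (Num.truncn e^-1).
  by rewrite invf_plt ?posrE// truncnS_gt.
have [y Ky yx] := Kx n Logic.I.
exists y; split => //; apply: eB; apply: (le_ball (ltW ne)).
exact: ball_sym.
Qed.

(** The thickenings of radius 1/(n+1) decrease to the closed set [K]. Finiteness is assumed near [K]
    only, so that this serves for Lebesgue measure as well as for [b]. *)
Lemma thickening_small (R : realType) (d : nat)
    (m : {measure set 'rV[R]_d -> \bar R}) (K : set 'rV[R]_d) (e : R) :
  closed K -> (m (thickening K 1) < +oo)%E -> m K = 0%E -> 0 < e ->
  exists2 r, 0 < r & (m (thickening K r) <= e%:E)%E.
Proof.
move=> cK Koo mK e0.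
have [||||//|n nP] :=
    @measure_bigcap_small R _ _ m (fun n => thickening K n.+1%:R^-1) e.
- by rewrite invr1.
- by move=> n; apply: open_measurable_rV; exact: open_thickening.
- move=> n p np; apply: sub_thickening.
  by rewrite lef_pV2 ?posrE// ler_nat.
- by rewrite bigcap_thickening.
- by exists n.+1%:R^-1.
Qed.

(** * Inner regularity of finite Borel measures on R^d *)

Section regularity.
Variables (R : realType) (d : nat).
Variable a : {finite_measure set 'rV[R]_d -> \bar R}.

Let afin A : measurable A -> (a A < +oo)%E.
Proof. by move=> mA; rewrite ltey_eq fin_num_measure. Qed.

(** Approximation from both sides makes the class stable under complement, which exchanges [F] and
    [U]; it is shown to be a sigma-algebra containing the open sets. *)
Let sandwiched := [set A : set 'rV[R]_d | forall e, 0 < e ->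
  exists F U, [/\ closed F, open U, F `<=` A, A `<=` U &
    (a (U `\` F) <= e%:E)%E]].

(** The points of [U] outside the thickenings of its complement form closed sets that increase to
    [U]. *)
Let sandwiched_open : open `<=` sandwiched.
Proof.
move=> U oU e e0.
have cU : closed (~` U) by exact: open_closedC.
have oT r : open (thickening (~` U) r) by exact: open_thickening.
have mT r : measurable (thickening (~` U) r) by exact: open_measurable_rV.
have mU : measurable U by exact: open_measurable_rV.
have [||||//|n nP] := @measure_bigcap_small R _ _ a
    (fun n => U `&` thickening (~` U) n.+1%:R^-1) e.
- by apply: afin; exact: measurableI.
- by move=> n; exact: measurableI.
- move=> n p np; apply: setIS; apply: sub_thickening.
  by rewrite lef_pV2 ?posrE// ler_nat.
- by rewrite bigcapIr ?bigcap_thickening ?setICr//; exists 0%N.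
exists (~` thickening (~` U) n.+1%:R^-1), U; split => //.
- exact: open_closedC.
- move=> x nx; apply: contrapT => Ux; apply: nx; exists x => //.
  exact: ballxx.
- by rewrite setDE setCK.
Qed.

Let sandwiched_bigcup (A : (set 'rV[R]_d)^nat) :
  (forall n, sandwiched (A n)) -> sandwiched (\bigcup_n A n).
Proof.
move=> GA e e0.
have /choice[F FP] n : exists F, exists U, [/\ closed F, open U, F `<=` A n,
    A n `<=` U & (a (U `\` F) <= (e / 2 / (2 ^ n.+1)%:R)%:E)%E].
  by apply: GA; rewrite !divr_gt0// ltr0n expn_gt0.
have {FP} /choice[U UP] := FP.
have cF n : closed (F n) by have [] := UP n.
have mF n : measurable (F n) by exact: closed_measurable_rV.
have mU n : measurable (U n) by apply: open_measurable_rV; have [] := UP n.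
have mFU n : measurable (U n `\` F n) by exact: measurableD.
pose V := \bigcup_n F n.
have mV : measurable V by exact: bigcup_measurable.
(* An infinite union of closed sets need not be closed, so a finite one is kept: for large [n] the
   rest costs at most half of [e], the other half going to the geometric errors. *)
pose S n := \bigcup_(i in `I_n) F i.
have cS n : closed (S n) by apply: closed_bigcup => //; exact: finite_II.
have mS n : measurable (S n) by exact: closed_measurable_rV.
have e20 : 0 < e / 2 by rewrite divr_gt0.
have [||||//|n nP] := @measure_bigcap_small R _ _ a (fun n => V `\` S n) (e / 2).
- by apply: afin; exact: measurableD.
- by move=> n; exact: measurableD.
- move=> n p np x [Vx Sx]; split=> // -[i /= ni Fx]; apply: Sx.
  by exists i => //=; exact: leq_trans np.
- rewrite (_ : \bigcap_n _ = set0) ?measure0//; apply/seteqP; split=> // x Hx.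
  have [[k _ Fk] _] := Hx 0%N Logic.I.
  by have [_] := Hx k.+1 Logic.I; apply; exists k => /=.
exists (S n), (\bigcup_n U n); split => //.
- by apply: bigcup_open => k _; have [] := UP k.
- by move=> x [i _ Fx]; exists i => //; have [_ _ + _ _] := UP i; apply.
- by move=> x [i _ Ax]; exists i => //; have [_ _ _ + _] := UP i; apply.
have mb : measurable (\bigcup_n (U n `\` F n)) by exact: bigcup_measurable.
apply: (@le_trans _ _ (a (\bigcup_n (U n `\` F n) `|` (V `\` S n)))).
  apply: le_measure; rewrite ?inE//.
  - by apply: measurableD => //; exact: bigcup_measurable.
  - by apply: measurableU => //; exact: measurableD.
  - move=> x [[i _ Ux] nS]; have [Fx|nF] := pselect (F i x).
      by right; split => //; exists i.
    by left; exists i.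
apply: (le_trans (measureU2 _ _ _)) => //; first exact: measurableD.
rewrite [e]splitr EFinD; apply: leeD => //.
apply: (le_trans (measure_sigma_subadditive a mFU mb (@subset_refl _ _))).
apply: le_trans (epsilon_trick0 _ (ltW e20)).
apply: lee_nneseries => // k _.
by have [] := UP k.
Qed.

Lemma closed_inner_regular (A : set 'rV[R]_d) (e : R) : measurable A -> 0 < e ->
  exists F, [/\ closed F, F `<=` A & (a (A `\` F) <= e%:E)%E].
Proof.
move=> mA e0.
have : sandwiched A.
  move: A mA; apply: smallest_sub sandwiched_open; split.
  - by apply: sandwiched_open; exact: open0.
  - move=> A GA r r0; have [F [U [cF oU FA AU UF]]] := GA r r0.
    exists (~` U), (~` F); split.
    + exact: open_closedC.
    + exact: closed_openC.
    + by rewrite setTD; exact: subsetC.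
    + by rewrite setTD; exact: subsetC.
    + by rewrite setDE setCK setIC -setDE.
  - exact: sandwiched_bigcup.
move=> /(_ e e0)[F [U [cF oU FA AU UF]]]; exists F; split => //.
apply: le_trans UF; apply: le_measure; rewrite ?inE.
- by apply: measurableD => //; exact: closed_measurable_rV.
- apply: measurableD; first exact: open_measurable_rV.
  exact: closed_measurable_rV.
- exact: setSD.
Qed.

(** A closed approximation is cut by a large closed cube; the mass lost tends to 0 because [a] is
    finite. *)
Lemma compact_inner_regular (A : set 'rV[R]_d) (e : R) : measurable A -> 0 < e ->
  exists K, [/\ compact K, K `<=` A & (a (A `\` K) <= e%:E)%E].
Proof.
move=> mA e0; have e20 : 0 < e / 2 by rewrite divr_gt0.
have [F [cF FA AF]] := closed_inner_regular mA e20.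
pose B n : set 'rV[R]_d := closed_ball 0 n.+1%:R.
have cB n : closed (B n) by exact: closed_ball_closed.
have mB n : measurable (B n) by exact: closed_measurable_rV.
have mF : measurable F by exact: closed_measurable_rV.
have BE n : B n = [set x | `|x| <= n.+1%:R].
  rewrite /B closed_ballE//; apply/seteqP.
  by split => x; rewrite /closed_ball_ /= sub0r normrN.
have [||||//|n nP] := @measure_bigcap_small R _ _ a (fun n => F `\` B n) (e / 2).
- by apply: afin; exact: measurableD.
- by move=> n; exact: measurableD.
- move=> n p np x [Fx nB]; split=> //; apply: contra_not nB.
  rewrite !BE/= => /le_trans; apply.
  by rewrite ler_nat.
- rewrite (_ : \bigcap_n _ = set0) ?measure0//; apply/seteqP; split=> // x Hx.
  have [_] := Hx (Num.truncn `|x|) Logic.I.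
  by apply; rewrite BE/= ltW// truncnS_gt.
exists (F `&` B n); split.
- apply: bounded_closed_compact; last exact: closedI.
  exists n.+1%:R; split; first exact: num_real.
  by move=> M nM x [_]; rewrite BE/= => /le_trans; apply; exact: ltW.
- by move=> x [/FA].
have -> : A `\` (F `&` B n) = (A `\` F) `|` (F `\` B n).
  apply/seteqP; split=> [x [Ax nFB]|x [[Ax nF]|[Fx nB]]].
  - have [Fx|nF] := pselect (F x); last by left.
    by right; split => // Bx; apply: nFB.
  - by split => // -[].
  - by split; [exact: FA|move=> []].
apply: (le_trans (measureU2 _ _ _)) => //; [exact: measurableD..|].
by rewrite [e]splitr EFinD; exact: leeD.
Qed.

End regularity.

(** * Lebesgue measure on arbitrary sets and on cubes *)

Section product_measure1_le.
Import HBNNSimple.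

(** The integral of a nonnegative function is a supremum over the simple functions below it, and
    this is monotone in the integrand without measurability. *)
Lemma product_measure1_le (R : realType) (d1 d2 : measure_display)
    (T1 : measurableType d1) (T2 : measurableType d2)
    (m1 : {measure set T1 -> \bar R}) (m2 : set T2 -> \bar R) :
  (forall A, 0 <= m2 A)%E -> {homo m2 : A B / A `<=` B >-> (A <= B)%E} ->
  {homo (m1 \x m2)%E : A B / A `<=` B >-> (A <= B)%E}.
Proof.
move=> m20 m2le A B AB; rewrite /product_measure1.
rewrite !ge0_integralTE; [|by move=> x /=..].
apply: ereal_sup_le => _ [h hA <-]; exists h => // x.
apply: (le_trans (hA x)); apply: m2le => y.
by rewrite /xsection/= !inE => /AB.
Qed.

End product_measure1_le.

(* [lebesgue_rV] is monotone even on non-measurable sets, so that superlevel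
   sets need not be shown measurable. *)
Lemma lebesgue_tuple_le (R : realType) (n : nat) :
  {homo @lebesgue_tuple R n : A B / A `<=` B >-> (A <= B)%E}.
Proof.
elim: n => [|n IH] A B AB /=.
  rewrite !diracE lee_fin ler_nat; case: (boolP (_ \in A)) => //.
  by rewrite inE => /AB /mem_set ->.
apply: product_measure1_le => //.
by apply: preimage_subset.
Qed.

Lemma lebesgue_rV_le (R : realType) (d : nat) :
  {homo @lebesgue_rV R d : A B / A `<=` B >-> (A <= B)%E}.
Proof. by move=> A B AB; apply: lebesgue_tuple_le; exact: preimage_subset. Qed.

Lemma lebesgue_rV_ball (R : realType) (d : nat) (x : 'rV[R]_d) (r : R) :
  0 < r -> lebesgue_rV R d (ball x r) = ((2 * r) ^+ d)%:E.
Proof.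
move=> r0; have -> : ball x r =
    [set y : 'rV[R]_d | forall i, (ball (x ord0 i) r : set R) (y ord0 i)].
  apply/seteqP; split=> y /=; first by move=> [_ By] i; exact: By.
  by move=> By; split => // i j; rewrite ord1.
rewrite (lebesgue_rV_box (A := fun i => ball (x ord0 i) r)); last first.
  by move=> i; apply: open_measurable; exact: ball_open.
under eq_bigr do rewrite lebesgue_measure_ball ?ltW//.
by rewrite prodEFin prodr_const card_ord mulr_natl.
Qed.

(** * Euclidean balls compared with cubes *)

Section euclidean_balls.
Variables (R : realType) (d : nat).
Implicit Types (x y : 'rV[R]_d) (r : R).

Lemma euclidean_ballE x r : 0 < r ->
  euclidean_ball x r =
  [set y | \sum_(i < d) (y ord0 i - x ord0 i) ^+ 2 < r ^+ 2].
Proof.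
move=> r0; apply/seteqP; split=> y; rewrite /euclidean_ball/=.
  move=> yr; rewrite -(@sqr_sqrtr _ (\sum_(_ < _) _)) ?sumr_ge0//.
    by rewrite ltr_pXn2r// nnegrE// ?sqrtr_ge0// ltW.
  by move=> i _; exact: sqr_ge0.
by move=> yr; rewrite -(gtr0_norm r0) -sqrtr_sqr ltr_sqrt// exprn_gt0.
Qed.

Lemma measurable_euclidean_ball x r : 0 < r -> measurable (euclidean_ball x r).
Proof.
move=> r0; rewrite euclidean_ballE// -[X in measurable X]setTI.
pose f y := \sum_(i < d) (y ord0 i - x ord0 i) ^+ 2.
have mf : measurable_fun [set: 'rV[R]_d] f.
  apply: measurable_sum => i; apply: measurable_funX.
  by apply: measurable_funB => //; exact: measurable_coord.
have := mf measurableT `]-oo, (r ^+ 2)[%classic (measurable_itv _).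
by congr (measurable _); congr (_ `&` _); apply/seteqP; split => y;
  rewrite /= in_itv.
Qed.

Lemma euclidean_ball_sub x r : 0 < r -> euclidean_ball x r `<=` ball x r.
Proof.
move=> r0; rewrite euclidean_ballE// => y /= yr; split => // i j.
rewrite ord1 -ball_normE/= distrC -(@ltr_pXn2r _ 2)// ?nnegrE ?(ltW r0)//.
rewrite real_normK ?num_real//; apply: le_lt_trans yr.
rewrite (bigD1 j)//= lerDl sumr_ge0// => k _; exact: sqr_ge0.
Qed.

(** The factor [d.+1] is a crude substitute for the square root of d: the sum of squares is at most
    d r^2, strictly less than (d+1)^2 r^2. *)
Lemma ball_sub_euclidean x r : 0 < r ->
  ball x r `<=` euclidean_ball x (d.+1%:R * r).
Proof.
move=> r0; rewrite euclidean_ballE ?mulr_gt0// => y [_ By] /=.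
apply: (@le_lt_trans _ _ (\sum_(i < d) r ^+ 2)).
  apply: ler_sum => i _; have := By ord0 i; rewrite -ball_normE/= distrC => yr.
  rewrite -real_normK ?num_real// ler_pXn2r ?nnegrE ?normr_ge0 ?(ltW r0)//.
  exact: ltW.
rewrite sumr_const card_ord -[ltLHS]mulr_natl exprMn ltr_pM2r ?exprn_gt0//.
by rewrite expr2 -natrM ltr_nat mulSn addSn ltnS leq_addr.
Qed.

(* A large value of [a] on [ball x r] that [b] cannot cancel on a larger
   concentric ball is seen from every point of [ball x r]. *)
Lemma ball_sub_superlevel (mu : {charge set 'rV[R]_d -> \bar R})
    (a b : {measure set 'rV[R]_d -> \bar R}) x r (l : R) :
  (forall A, measurable A -> a A - b A <= `|mu A|)%E ->
  0 < r -> 0 < l ->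
  let L := l * (2 * d.+1%:R) ^+ d in
  ((2 * L * (2 * r) ^+ d)%:E <= a (ball x r))%E ->
  (b (ball x (3 * d.+1%:R * r)) < (L * (2 * r) ^+ d)%:E)%E ->
  ball x r `<=` [set y | (l%:E < maximal_function mu y)%E].
Proof.
move=> abmu r0 l0 L ar br y xy /=.
have mball z q : measurable (ball z q : set 'rV[R]_d).
  by apply: open_measurable_rV; exact: ball_open.
have s1 : 1 <= d.+1%:R :> R by rewrite ler1n.
set s : R := d.+1%:R in L ar br s1 *.
have s0 : 0 < s by exact: lt_le_trans s1.
(* Points of [ball x r] are at sup distance less than [2 * r] from [y], so the Euclidean ball of
   radius [q] about [y] contains [ball x r]; it stays within [r + q <= 3 * s * r] of [x], as
   [1 <= s]. *)
pose q := s * (2 * r).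
have q0 : 0 < q by rewrite !mulr_gt0.
pose E := euclidean_ball y q.
have mE : measurable E by exact: measurable_euclidean_ball.
have xE : ball x r `<=` E.
  apply: (subset_trans _ (ball_sub_euclidean _)); last by rewrite mulr_gt0.
  move=> z xz; rewrite mulr_natl mulr2n.
  exact: ball_triangle (ball_sym xy) xz.
have Ex : E `<=` ball x (3 * s * r).
  move=> z /(euclidean_ball_sub q0) yz.
  apply: (@le_ball _ _ _ (r + q)).
    by rewrite /q -subr_ge0 (_ : _ - _ = (s - 1) * r); [nra|ring].
  exact: ball_triangle xy yz.
have LE0 : (0 < lebesgue_rV R d E)%E.
  apply: lt_le_trans (lebesgue_rV_le xE).
  by rewrite lebesgue_rV_ball// lte_fin exprn_gt0// mulr_gt0.
have LEq : (lebesgue_rV R d E <= ((2 * q) ^+ d)%:E)%E.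
  by rewrite -(lebesgue_rV_ball y)// lebesgue_rV_le//; exact: euclidean_ball_sub.
have Lq : l * (2 * q) ^+ d = L * (2 * r) ^+ d.
  by rewrite /L /q -mulrA -exprMn; congr (_ * _ ^+ _); ring.
have LEfin : lebesgue_rV R d E \is a fin_num.
  by rewrite ge0_fin_numE ?ltW// (le_lt_trans LEq)// ltry.
apply: (@lt_le_trans _ _ (`|mu E| / lebesgue_rV R d E)%E); last first.
  by apply: ereal_sup_ubound; exists q.
move: LE0 LEq; rewrite -(fineK LEfin) lte_fin lee_fin => LE0 LEq.
rewrite inver gt_eqF// lte_pdivlMr//.
(* Of the mass at least [2 * L * (2 * r) ^+ d] that [a] has on [ball x r], [b] cancels less than
   half. *)
apply: (@le_lt_trans _ _ (L * (2 * r) ^+ d)%:E).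
  by rewrite -EFinM lee_fin -Lq ler_pM2l.
apply: lt_le_trans (abmu _ mE).
apply: (@lt_le_trans _ _ (a (ball x r) - b (ball x (3 * s * r)))%E); last first.
  by apply: leeB; apply: le_measure; rewrite ?inE.
have bfin : b (ball x (3 * s * r)) \is a fin_num.
  by rewrite ge0_fin_numE// (lt_trans br)// ltry.
rewrite lteBrDr//.
apply: lt_le_trans ar.
rewrite (_ : 2 * L * _ = L * (2 * r) ^+ d + L * (2 * r) ^+ d); last by ring.
by rewrite EFinD lteD2lE.
Qed.

End euclidean_balls.

(** * Covering argument for one Jordan part *)

Section core.
Variables (R : realType) (d : nat).
Local Notation L := (lebesgue_rV R d).
Let s : R := d.+1%:R.

(** Any admissible radius above half the supremum of the admissible ones works, since [t >= 2 * r]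
    then exceeds the supremum. The bound on the total mass keeps them below [delta], whatever the
    center [x]. *)
Lemma almost_maximal_radius (a : {measure set 'rV[R]_d -> \bar R})
    (x : 'rV[R]_d) (l delta : R) :
  0 < l -> 0 < delta -> (a setT < (l * (2 * delta) ^+ d)%:E)%E ->
  (exists2 r, 0 < r & ((l * (2 * r) ^+ d)%:E <= a (ball x r))%E) ->
  exists r, [/\ 0 < r, r < delta, ((l * (2 * r) ^+ d)%:E <= a (ball x r))%E &
    forall t, 2 * r <= t -> (a (ball x t) < (l * (2 * t) ^+ d)%:E)%E].
Proof.
move=> l0 delta0 aT [r0 r00 ar0].
pose S := [set r | 0 < r /\ ((l * (2 * r) ^+ d)%:E <= a (ball x r))%E].
have Sr0 : S r0 by [].
have Slt r : S r -> r < delta.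
  move=> [rgt0 ar]; rewrite ltNge; apply/negP => deltar.
  have : (a setT < a setT)%E; last by rewrite ltxx.
  apply: (lt_le_trans aT); apply: (@le_trans _ _ (l * (2 * r) ^+ d)%:E).
    rewrite lee_fin ler_pM2l//; apply: lerXn2r.
    - by rewrite nnegrE mulr_ge0// ltW.
    - by rewrite nnegrE mulr_ge0// ltW.
    - by rewrite ler_pM2l.
  apply: (le_trans ar); apply: le_measure; rewrite ?inE//.
  by apply: open_measurable_rV; exact: ball_open.
have supS : has_sup S.
  by split; [exists r0|exists delta => r /Slt/ltW].
have sup0 : 0 < sup S by apply: lt_le_trans r00 _; exact: ub_le_sup supS.2 _ _.
have [r Sr supr] : exists2 r, S r & sup S - sup S / 2 < r.
  by apply: sup_adherent => //; rewrite divr_gt0.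
have [rgt0 ar] := Sr.
exists r; split => //; first exact: Slt.
move=> t rt; rewrite ltNge; apply/negP => at_.
have t0 : 0 < t by apply: lt_le_trans rt; rewrite mulr_gt0.
have : t <= sup S by apply: (ub_le_sup supS.2); split.
lra.
Qed.

Lemma compact_thickening_lty (K : set 'rV[R]_d) :
  compact K -> (L (thickening K 1) < +oo)%E.
Proof.
move=> /compact_bounded[M [_ KM]].
have M0 : 0 < `|M| + 2 by rewrite ltr_wpDl.
apply: (@le_lt_trans _ _ (L (ball 0 (`|M| + 2)))); last first.
  by rewrite lebesgue_rV_ball// ltry.
apply: lebesgue_rV_le => y [x Kx xy].
apply: (@le_ball _ _ _ (`|M| + 1 + 1)); first by rewrite -addrA.
apply: ball_triangle xy; rewrite -ball_normE/= sub0r normrN.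
apply: (@le_lt_trans _ _ (`|M| + 2^-1)); last by rewrite ltrD2l; lra.
by apply: KM => //; apply: le_lt_trans (ler_norm M) _; rewrite ltrDl.
Qed.

(** The power combines [3 ^+ d] from Vitali and [(2 * d.+1%:R) ^+ d] from comparing Euclidean balls
    with cubes. In 8, one factor 2 is the room left for cancellation, one is lost in passing to a
    compact set, one in discarding two of the three families. *)
Definition weak_type_const : R := (8 * (6 * d.+1%:R) ^+ d)^-1.

Lemma weak_type_const_gt0 : 0 < weak_type_const.
Proof. by rewrite invr_gt0 mulr_gt0// exprn_gt0// mulr_gt0. Qed.

Section one_sign.
Variable mu : {charge set 'rV[R]_d -> \bar R}.
Variables a b : {finite_measure set 'rV[R]_d -> \bar R}.
(** This form holds for the Jordan parts of [mu] taken in either order. *)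
Hypothesis abmu : forall A, measurable A -> (a A - b A <= `|mu A|)%E.

Let superlevel (l : R) := [set x | (l%:E < maximal_function mu x)%E].

(** Each alternative bounds [a] on the tripled ball, as Vitali's selection requires, by a measure
    that is small near [K] ([L] or [b]) or by [L] inside the superlevel set. *)
Let covering_ball (l delta0 delta1 : R) (K : set 'rV[R]_d) (x : 'rV[R]_d) :
  let l' := 2 * (l * (2 * s) ^+ d) in
  0 < l -> 0 < delta0 -> 0 < delta1 ->
  (a setT < (l' * (2 * (delta0 / (3 * s))) ^+ d)%:E)%E -> K x ->
  exists2 r, 0 < r &
    [\/ (a (ball x (3 * r)) <= (l' * 3 ^+ d)%:E * L (ball x r))%E /\
        ball x r `<=` thickening K delta1,
        (a (ball x (3 * r)) <= (2 * (9 * s) ^+ d)%:E * b (ball x r))%E /\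
        ball x r `<=` thickening K delta0 |
        (a (ball x (3 * r)) <= (l' * 3 ^+ d)%:E * L (ball x r))%E /\
        ball x r `<=` superlevel l].
Proof.
move=> l' l0 delta00 delta10 aT Kx.
have s1 : 1 <= s by rewrite /s ler1n.
have s0 : 0 < s by exact: lt_le_trans s1.
have l'0 : 0 < l' by rewrite !mulr_gt0// exprn_gt0// mulr_gt0.
have [exr|nexr] := pselect (exists2 r, 0 < r &
    ((l' * (2 * r) ^+ d)%:E <= a (ball x r))%E); last first.
  (* With no admissible radius any size will do; inadmissibility is used at [3 * delta1]. *)
  exists delta1 => //; apply: Or31; split; last by move=> y xy; exists x.
  rewrite lebesgue_rV_ball// -EFinM -mulrA -exprMn mulrCA.
  rewrite leNgt; apply/negP => /ltW al; apply: nexr.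
  by exists (3 * delta1) => //; rewrite mulr_gt0.
have [|r [r0 rdelta ar rmax]] := almost_maximal_radius l'0 _ aT exr.
  by rewrite divr_gt0// mulr_gt0.
have [br|br] := ltP (b (ball x (3 * s * r))) (l * (2 * s) ^+ d * (2 * r) ^+ d)%:E.
  exists r => //; apply: Or33; split.
    rewrite lebesgue_rV_ball// -EFinM -mulrA -exprMn mulrCA.
    by apply: ltW; apply: rmax; rewrite ler_pM2r// ler_nat.
  exact: ball_sub_superlevel ar br.
exists (3 * s * r); first by rewrite !mulr_gt0.
apply: Or32; split; last first.
  move=> y xy; exists x => //; apply: le_ball xy.
  by rewrite mulrC -ler_pdivlMr ?mulr_gt0// ltW.
(* Near-maximality is used at [9 * s * r], the tripled radius; comparing with the lower bound on [b]
   gives the constant [2 * (9 * s) ^+ d]. *)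
apply: (@le_trans _ _ (l' * (2 * (3 * (3 * s * r))) ^+ d)%:E).
  apply: ltW; apply: rmax; rewrite !mulrA ler_pM2r// -!natrM.
  nra.
apply: (@le_trans _ _ ((2 * (9 * s) ^+ d)%:E *
    (l * (2 * s) ^+ d * (2 * r) ^+ d)%:E)%E); last first.
  by apply: lee_wpmul2l => //; rewrite lee_fin mulr_ge0// exprn_ge0// mulr_ge0// ltW.
rewrite -EFinM lee_fin (_ : 2 * (3 * (3 * s * r)) = 9 * s * (2 * r)); last by ring.
by rewrite (exprMn _ (9 * s)) /l' le_eqVlt; apply/orP; left; apply/eqP; ring.
Qed.

Lemma superlevel_lower_bound (A : set 'rV[R]_d) :
  measurable A -> L A = 0%E -> b A = 0%E ->
  exists l0 : R, forall l, l0 < l ->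
    (weak_type_const%:E * a A <= l%:E * L (superlevel l))%E.
Proof.
move=> mA LA bA.
have afin U : measurable U -> a U \is a fin_num by exact: fin_num_measure.
have s0 : 0 < s by rewrite /s.
have := afin _ mA; move aAE : (a A) => [alpha| |]// _.
have : (0 <= alpha%:E)%E by rewrite -aAE.
rewrite lee_fin le_eqVlt => /predU1P[<-|alpha0].
  exists 0 => l l0; rewrite mule0 mule_ge0// ?lee_fin ?ltW//.
have [K [cK KA AK]] := compact_inner_regular a mA (divr_gt0 alpha0 (ltr0n _ 2)).
have clK : closed K by apply: compact_closed => //; exact: norm_hausdorff.
have mK : measurable K by exact: closed_measurable_rV.
have mAK : measurable (A `\` K) by exact: measurableD.
have null (m : {measure set 'rV[R]_d -> \bar R}) : m A = 0%E -> m K = 0%E.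
  move=> mA0; apply/eqP; rewrite eq_le measure_ge0 andbT -mA0.
  by apply: le_measure; rewrite ?inE.
pose k := fine (a K); have kE : a K = k%:E by rewrite fineK// afin.
have alphak : alpha / 2 <= k.
  rewrite -(lerD2r (alpha / 2)) -splitr -lee_fin EFinD -kE -aAE.
  rewrite -(setDKU KA) addeC; apply: (le_trans (measureU2 _ _ _)) => //.
  exact: leeD2r.
have k0 : 0 < k by apply: lt_le_trans alphak; rewrite divr_gt0.
pose C2 := 2 * (9 * s) ^+ d.
have C20 : 0 < C2 by rewrite mulr_gt0// exprn_gt0// mulr_gt0.
have [|delta0 delta00 bK] := thickening_small clK _ (null b bA)
    (divr_gt0 (divr_gt0 k0 (ltr0n _ 4)) C20).
  rewrite ltey_eq fin_num_measure//; apply: open_measurable_rV.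
  exact: open_thickening.
(* [l * w] is the bound that [covering_ball] requires above the mass of [a]. As [delta0] was chosen
   independently of [l], this is an explicit threshold for [l]. *)
pose w := 2 * (2 * s) ^+ d * (2 * (delta0 / (3 * s))) ^+ d.
have w0 : 0 < w.
  by rewrite !mulr_gt0// exprn_gt0// ?mulr_gt0// invr_gt0 mulr_gt0.
have aTfin := afin _ (@measurableT _ 'rV[R]_d).
exists (fine (a setT) / w) => l; rewrite ltr_pdivrMr// => ltw.
have l0 : 0 < l.
  by rewrite -(pmulr_lgt0 _ w0); apply: le_lt_trans ltw; rewrite fine_ge0.
pose l' := 2 * (l * (2 * s) ^+ d).
have l'0 : 0 < l' by rewrite !mulr_gt0// exprn_gt0// mulr_gt0.
pose C1 := l' * 3 ^+ d.
have C10 : 0 < C1 by rewrite mulr_gt0// exprn_gt0.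
have aT : (a setT < (l' * (2 * (delta0 / (3 * s))) ^+ d)%:E)%E.
  rewrite -(fineK aTfin) lte_fin; apply: (lt_le_trans ltw).
  by rewrite le_eqVlt; apply/orP; left; apply/eqP; rewrite /w /l'; ring.
(* Unlike [delta0], this radius may depend on [l], and does so through [C1]. *)
have [delta1 delta10 LK] := thickening_small clK (compact_thickening_lty cK)
    (null L LA) (divr_gt0 (divr_gt0 k0 (ltr0n _ 4)) C10).
pose P1 (p : 'rV[R]_d * R) :=
  (a (ball p.1 (3 * p.2)) <= C1%:E * L (ball p.1 p.2))%E /\
  ball p.1 p.2 `<=` thickening K delta1.
pose P2 (p : 'rV[R]_d * R) :=
  (a (ball p.1 (3 * p.2)) <= C2%:E * b (ball p.1 p.2))%E /\
  ball p.1 p.2 `<=` thickening K delta0.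
pose P3 (p : 'rV[R]_d * R) :=
  (a (ball p.1 (3 * p.2)) <= C1%:E * L (ball p.1 p.2))%E /\
  ball p.1 p.2 `<=` superlevel l.
(* The radius 0 outside [K] is a dummy value: the centers of the subcover lie in [K]. *)
have /choice[rho rhoP] x : exists r, K x ->
    0 < r /\ [\/ P1 (x, r), P2 (x, r) | P3 (x, r)].
  have [Kx|nK] := pselect (K x); last by exists 0.
  by have [r r0 rP] := covering_ball l0 delta00 delta10 aT Kx; exists r.
move: cK; rewrite compact_cover => /(_ _ K (fun x => ball x (rho x))).
case=> [x Kx|x Kx|D' D'K KD']; first exact: ball_open.
  by exists x => //; apply: ballxx; exact: (rhoP x Kx).1.
pose t (P : 'rV[R]_d * R -> Prop) :=
  [seq p <- [seq (x, rho x) | x <- finmap.enum_fset D'] | `[< P p >]].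
have tP P p : p \in t P -> 0 < p.2 /\ P p.
  rewrite mem_filter => /andP[/asboolP Pp /mapP[x xD' pE]]; split => //.
  by rewrite pE /=; have [] := rhoP x (set_mem (D'K _ xD')).
have mt P : measurable (ball_union (t P)).
  by apply: open_measurable_rV; exact: open_ball_union.
have Kt : K `<=` ball_union (t P1) `|` ball_union (t P2) `|` ball_union (t P3).
  move=> x Kx; have [y yD' yx] := KD' x Kx.
  have [_ yP] := rhoP y (set_mem (D'K _ yD')).
  have ty P : P (y, rho y) -> ball_union (t P) x.
    move=> Py; exists (y, rho y) => //=.
    by rewrite mem_filter; apply/andP; split; [exact/asboolP|exact: map_f].
  by case: yP => /ty; [left; left|left; right|right].
have bu_sub P U : (forall p, P p -> ball p.1 p.2 `<=` U) ->
    ball_union (t P) `<=` U.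
  by move=> PU x [p /= /tP[_ /PU]]; exact.
have at1 : (a (ball_union (t P1)) <= (k / 4)%:E)%E.
  have := vitali_measure_le (a := a) (m := L) (s := t P1).
  move=> /(_ C1) /(_ _ (ltW C10)) H; apply: le_trans (H _) _.
    by move=> p /tP[p0 []].
  rewrite -[X in (_ <= X%:E)%E](divfK (lt0r_neq0 C10)) (mulrC _ C1) [leRHS]EFinM.
  apply: lee_wpmul2l; first by rewrite lee_fin ltW.
  apply: le_trans LK; apply: lebesgue_rV_le; apply: bu_sub.
  by move=> p [].
have at2 : (a (ball_union (t P2)) <= (k / 4)%:E)%E.
  have := vitali_measure_le (a := a) (m := b) (s := t P2).
  move=> /(_ C2) /(_ _ (ltW C20)) H; apply: le_trans (H _) _.
    by move=> p /tP[p0 []].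
  rewrite -[X in (_ <= X%:E)%E](divfK (lt0r_neq0 C20)) (mulrC _ C2) [leRHS]EFinM.
  apply: lee_wpmul2l; first by rewrite lee_fin ltW.
  apply: le_trans bK; apply: le_measure; rewrite ?inE//.
    by apply: open_measurable_rV; exact: open_thickening.
  by apply: bu_sub => p [].
have at3 : (a (ball_union (t P3)) <= C1%:E * L (superlevel l))%E.
  have := vitali_measure_le (a := a) (m := L) (s := t P3).
  move=> /(_ C1) /(_ _ (ltW C10)) H; apply: le_trans (H _) _.
    by move=> p /tP[p0 []].
  apply: lee_wpmul2l; first by rewrite lee_fin ltW.
  by apply: lebesgue_rV_le; apply: bu_sub => p [].
(* The first two families absorb at most half of [a K], so at least [alpha / 4] is left for the
   superlevel set. *)
have : (k%:E <= (k / 4)%:E + (k / 4)%:E + C1%:E * L (superlevel l))%E.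
  rewrite -kE; apply: le_trans (_ : (a (ball_union (t P1) `|`
    ball_union (t P2) `|` ball_union (t P3)) <= _)%E).
    apply: le_measure; rewrite ?inE//.
    by apply: measurableU => //; exact: measurableU.
  apply: (le_trans (measureU2 _ _ _)) => //; first exact: measurableU.
  apply: leeD => //; apply: (le_trans (measureU2 _ _ _)) => //.
  exact: leeD.
have : (0 <= L (superlevel l))%E by exact: measure_ge0.
case: (L (superlevel l)) => [X| |] // X0.
- rewrite -!EFinM -!EFinD !lee_fin => kX.
  have -> : weak_type_const * alpha = alpha / 4 / (2 * (6 * s) ^+ d).
    rewrite /weak_type_const -/s (_ : 8 = 4 * 2); last by ring.
    by rewrite -mulrA invfM mulrC mulrA.
  rewrite ler_pdivrMr; last by rewrite mulr_gt0// exprn_gt0// mulr_gt0.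
  have C1E : C1 = 2 * (6 * s) ^+ d * l.
    rewrite /C1 /l' (_ : 6 * s = 3 * (2 * s)); last by ring.
    by rewrite [in RHS]exprMn; ring.
  rewrite (_ : l * X * _ = C1 * X); last by rewrite C1E; ring.
  lra.
- by move=> _; rewrite gt0_muley ?lte_fin// leey.
Qed.

End one_sign.
End core.

(** * Variation of the singular part *)

Section singular_variation.
Context (dsp : measure_display) (T : measurableType dsp) (R : realType).
Variables (mu nus : {charge set T -> \bar R}).

Lemma jordan_posI (P Q : set T) (h : hahn_decomposition mu P Q) (A : set T) :
  measurable A -> jordan_pos h A = mu (A `&` P).
Proof. by move=> mA; rewrite jordan_posE cjordan_posE /crestr0 mem_set. Qed.

Lemma jordan_negI (P Q : set T) (h : hahn_decomposition mu P Q) (A : set T) :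
  measurable A -> jordan_neg h A = (- mu (A `&` Q))%E.
Proof. by move=> mA; rewrite jordan_negE cjordan_negE /crestr0 mem_set. Qed.

(** [nus] is the restriction of [mu] to [N], so its variation is at most that of [mu] on the
    disjoint pieces of [N] cut by [P'] and [Q']. The two Hahn decompositions are unrelated because
    [charge_total_variation] picks one by choice. *)
Lemma charge_variation_restr_le (P Q P' Q' N : set T)
    (h : hahn_decomposition mu P Q) (h' : hahn_decomposition nus P' Q') :
  measurable N -> nus.-null_set (~` N) ->
  (forall A, measurable A -> A `<=` N -> nus A = mu A) ->
  (charge_variation h' setT <= charge_variation h N)%E.
Proof.
move=> mN nus0 nusmu.
have [[mP' _] [mQ' _] _ PQ'] := h'.
have nusN A : measurable A -> nus A = mu (A `&` N).
  move=> mA; rewrite (chargeDI nus mA mN).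
  rewrite (_ : nus (A `\` N) = 0%E) ?add0e; last first.
    by apply: nus0; [exact: measurableD|move=> x []].
  by apply: nusmu; [exact: measurableI|move=> x []].
have V_ge A : measurable A -> (`|mu (A `&` N)| <= charge_variation h (A `&` N))%E.
  by move=> mA; apply: abse_charge_variation; exact: measurableI.
rewrite {1}/charge_variation jordan_posE cjordan_posE jordan_negE cjordan_negE.
rewrite /crestr0 mem_set// /crestr !setTI !nusN//.
apply: (@le_trans _ _
    (charge_variation h (P' `&` N) + charge_variation h (Q' `&` N))%E).
  apply: leeD; apply: le_trans (V_ge _ _) => //; first exact: lee_abs.
  by rewrite -abseN lee_abs.
rewrite -measureU; [|exact: measurableI|exact: measurableI|].
  apply: le_measure; rewrite ?inE//; first by apply: measurableU; exact: measurableI.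
  by move=> x [] [].
by rewrite setIACA PQ' set0I.
Qed.

End singular_variation.

(** Inside the null set [N] that carries the singular part, the absolutely continuous part vanishes,
    so the singular part coincides with [mu] there. *)
Lemma total_variation_singular_part_le (dsp : measure_display)
    (T : measurableType dsp) (R : realType) (m : {measure set T -> \bar R})
    (mu : {charge set T -> \bar R}) (P Q : set T)
    (h : hahn_decomposition mu P Q) :
  exists N, [/\ measurable N, m N = 0%E &
    (charge_total_variation (singular_part m mu) setT
      <= charge_variation h N)%E].
Proof.
have [nua [/null_content_dominatesP nuam [N [mN mN0 nus0]] muE]] :=
  singular_partP m mu.
exists N; split => //; rewrite /charge_total_variation.
apply: charge_variation_restr_le => // A mA AN.
rewrite muE// nuam ?add0e//.
by apply/eqP; rewrite eq_le measure_ge0 andbT -mN0 le_measure ?inE.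
Qed.

(** * Lower limit at infinity and sum of the two one-sided bounds *)

Lemma le_limf_einf_pinfty (R : realType) (f : R -> \bar R) (c : \bar R) (l0 : R) :
  (forall l, l0 < l -> (c <= f l)%E) -> (c <= limf_einf f (pinfty_nbhs R))%E.
Proof.
move=> cf; rewrite limf_einfE; apply: le_ereal_sup_tmp.
exists (ereal_inf (f @` [set l | l0 < l])).
  by exists [set l | l0 < l] => //; exists l0; split => //; exact: num_real.
by apply: le_ereal_inf_tmp => _ [l l0l <-]; exact: cf.
Qed.

Unset Implicit Arguments.

Theorem theorem1p4 (R : realType) (d : nat) (hd : (1 <= d)%N) :
  exists c : R, 0 < c /\
    forall mu : {charge set 'rV[R]_d -> \bar R},
      (c%:E * charge_total_variation (singular_part (lebesgue_rV R d) mu) [set: 'rV[R]_d]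
       <= limf_einf
            (fun lambda : R =>
               lambda%:E *
               lebesgue_rV R d [set x | lambda%:E < maximal_function mu x])
            (pinfty_nbhs R))%E.
Proof.
(* The constant is halved because the bounds for the two Jordan parts concern the same superlevel
   set and are added. *)
exists (weak_type_const R d / 2); split.
  by rewrite divr_gt0// weak_type_const_gt0.
move=> mu; have [P [Q h]] := Hahn_decomposition mu.
have [[mP _] [mQ _] _ PQ] := h.
have [N [mN LN TV]] := total_variation_singular_part_le (lebesgue_rV R d) h.
have mNP : measurable (N `&` P) by exact: measurableI.
have mNQ : measurable (N `&` Q) by exact: measurableI.
have LI A : measurable A -> lebesgue_rV R d (N `&` A) = 0%E.
  move=> mA; apply/eqP; rewrite eq_le measure_ge0 andbT -LN.
  by apply: lebesgue_rV_le => x [].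
have muE A : measurable A -> mu A = (jordan_pos h A - jordan_neg h A)%E.
  by move=> mA; rewrite (jordan_decomp h mA) /cadd/= cscaleN1.
have pos_le A : measurable A -> (jordan_pos h A - jordan_neg h A <= `|mu A|)%E.
  by move=> mA; rewrite -muE// lee_abs.
have neg_le A : measurable A -> (jordan_neg h A - jordan_pos h A <= `|mu A|)%E.
  move=> mA; rewrite muE// -abseN fin_num_oppeB ?fin_num_measure// addeC.
  exact: lee_abs.
have negP0 : jordan_neg h (N `&` P) = 0%E.
  by rewrite jordan_negI// -setIA PQ setI0 charge0 oppe0.
have posQ0 : jordan_pos h (N `&` Q) = 0%E.
  by rewrite jordan_posI// -setIA (setIC Q) PQ setI0 charge0.
(* The parts of [N] in [P] and in [Q] are Lebesgue null, and each is null for one Jordan part, so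
   the one-sided bound applies twice with the roles exchanged. *)
have [l1 pos_bound] := superlevel_lower_bound pos_le mNP (LI P mP) negP0.
have [l2 neg_bound] := superlevel_lower_bound neg_le mNQ (LI Q mQ) posQ0.
apply: (@le_limf_einf_pinfty _ _ _ (Num.max l1 l2)) => l.
rewrite gt_max => /andP[/pos_bound/= pos_l /neg_bound/= neg_l].
have c0 := weak_type_const_gt0 R d.
apply: (@le_trans _ _ ((weak_type_const R d / 2)%:E * charge_variation h N)%E).
  by apply: lee_wpmul2l => //; rewrite lee_fin divr_ge0// ltW.
move: pos_l neg_l; rewrite /charge_variation.
rewrite (_ : jordan_pos h (N `&` P) = jordan_pos h N); last first.
  by rewrite !jordan_posI// -setIA setIid.
rewrite (_ : jordan_neg h (N `&` Q) = jordan_neg h N); last first.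
  by rewrite !jordan_negI// -setIA setIid.
have : jordan_pos h N \is a fin_num by exact: fin_num_measure.
have : jordan_neg h N \is a fin_num by exact: fin_num_measure.
move: (jordan_pos h N) (jordan_neg h N) => [p| |] [q| |]// _ _.
case: (_ * lebesgue_rV R d _)%E => [X| |] /=; [|by rewrite !leey|by []].
rewrite -EFinD -!EFinM !lee_fin; lra.
Qed.
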